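(* Let $A = A_s + \epsilon A_i$ be an $n\times n$ dual complex matrix which is symmetric, i.e. $A_s, A_i \in \mathbb{C}^{n\times n}$ satisfy $A_s^\top = A_s$ and $A_i^\top = A_i$. Then there exist a unitary dual complex matrix $V = V_s + \epsilon V_i$ with $V_s,V_i\in\mathbb{C}^{n\times n}$ and a dual real diagonal matrix $\Sigma = \Sigma_s + \epsilon\Sigma_i$ with $\Sigma_s,\Sigma_i\in\mathbb{R}^{n\times n}$ diagonal such that $$A = V\Sigma V^\top .$$
   Context: For $\mathbb{F}\in\{\mathbb{R},\mathbb{C}\}$, a dual matrix over $\mathbb{F}$ is a formal expression $A = A_s+\epsilon A_i$ with $A_s, A_i\in\mathbb{F}^{m\times n}$ (the standard and infinitesimal parts), where $\epsilon$ commutes with everything and $\epsilon^2=0$. Thus addition is componentwise and $(A_s+\epsilon A_i)(B_s+\epsilon B_i) = A_sB_s+\epsilon(A_sB_i+A_iB_s)$. The transpose is $A^\top = A_s^\top+\epsilon A_i^\top$ (no conjugation), and the conjugate transpose is $A^* = A_s^*+\epsilon A_i^*$. An $n\times n$ dual complex matrix $V=V_s+\epsilon V_i$ is unitary if $VV^*=I_n$, i.e. $V_sV_s^*=I_n$ and $V_sV_i^*+V_iV_s^*=O$. *)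

(* Defs.v *)
From mathcomp Require Import all_boot all_order all_algebra.
From mathcomp Require Import complex reals.

Set Implicit Arguments.
Unset Strict Implicit.
Unset Printing Implicit Defensive.

Import GRing.Theory Num.Theory.
Local Open Scope ring_scope.
Local Open Scope sesquilinear_scope.

(* [DualMx As Ai] is the formal expression As + eps Ai, with eps central and
   eps^2 = 0. *)
Record dualmx (F : Type) (m n : nat) : Type := DualMx {
  dual_std : 'M[F]_(m, n);
  dual_inf : 'M[F]_(m, n)
}.

Definition dual_mulmx (F : pzRingType) (m n p : nat)
    (A : dualmx F m n) (B : dualmx F n p) : dualmx F m p :=
  DualMx (dual_std A *m dual_std B)
         (dual_std A *m dual_inf B + dual_inf A *m dual_std B).

Definition dual_1mx (F : pzRingType) (n : nat) : dualmx F n n := DualMx 1%:M 0.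

Definition dual_trmx (F : Type) (m n : nat) (A : dualmx F m n) : dualmx F n m :=
  DualMx (dual_std A)^T (dual_inf A)^T.

Definition dual_ctrmx (C : numClosedFieldType) (m n : nat)
    (A : dualmx C m n) : dualmx C n m :=
  DualMx ((dual_std A)^t*) ((dual_inf A)^t*).

Definition dual_map (F G : Type) (f : F -> G) (m n : nat)
    (A : dualmx F m n) : dualmx G m n :=
  DualMx (map_mx f (dual_std A)) (map_mx f (dual_inf A)).

Definition dual_symmetric (F : Type) (n : nat) (A : dualmx F n n) : Prop :=
  dual_trmx A = A.

Definition dual_unitary (C : numClosedFieldType) (n : nat)
    (V : dualmx C n n) : Prop :=
  dual_mulmx V (dual_ctrmx V) = dual_1mx C n.

Definition dual_diagonal (F : pzRingType) (n : nat) (A : dualmx F n n) : Prop :=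
  is_diag_mx (dual_std A) /\ is_diag_mx (dual_inf A).

Lemma dual_symmetricP (F : Type) (n : nat) (A : dualmx F n n) :
  dual_symmetric A <->
  (dual_std A)^T = dual_std A /\ (dual_inf A)^T = dual_inf A.
Proof. by case: A => As Ai; split=> [[]|[/= sAs sAi]] //; congr DualMx. Qed.

Lemma dual_unitaryP (C : numClosedFieldType) (n : nat) (V : dualmx C n n) :
  dual_unitary V <->
  dual_std V *m (dual_std V)^t* = 1%:M /\
  dual_std V *m (dual_inf V)^t* + dual_inf V *m (dual_std V)^t* = 0.
Proof. by split=> [[]|[/= eVs eVi]] //; congr DualMx. Qed.

(* Main.v *)
Require Import Defs.
From mathcomp Require Import all_boot all_order all_algebra.
From mathcomp Require Import complex reals.
Local Open Scope ring_scope.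
Local Open Scope complex_scope.
Import Order.TTheory GRing.Theory Num.Theory Num.Def.
Local Open Scope sesquilinear_scope.

(** Deflation over the dual numbers. The antilinear map [x |-> conj x A] on rows is
    a dual real symmetric operator on real and imaginary parts, so it has a dual
    eigenvector [x + eps y] with dual real eigenvalue [sigma + eps mu]: in the
    kernel of [M - sigma], take for [x] an eigenvector of the compression of the
    infinitesimal part. Normalise it, complete it to the first row of a dual
    unitary [Q]; then [conj Q A Q^*] is symmetric with first row
    [(sigma + eps mu, 0, ..., 0)], and one concludes by induction. No discussion
    of equal or vanishing singular values is needed. *)

(** * Dual eigenvectors of real symmetric matrices *)

Lemma conj_map_real_complex (R : rcfType) (m n : nat) (A : 'M[R]_(m, n)) :
  map_mx conjC (map_mx (real_complex R) A) = map_mx (real_complex R) A.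
Proof. by apply/matrixP => i j; rewrite !mxE; exact: conjc_real. Qed.

Lemma trmxC_mul (C : numClosedFieldType) (m n p : nat)
    (A : 'M[C]_(m, n)) (B : 'M[C]_(n, p)) : (A *m B)^t* = B^t* *m A^t*.
Proof. by rewrite trmx_mul map_mxM. Qed.

(** The rows of [K] need not be orthonormal, so the compression of [P] to their span is
    [K P K^T G^-1] with Gram matrix [G = K K^T]. It is self-adjoint for the inner product defined by
    [G], hence its eigenvalues are real. *)
Lemma symmetric_compression_eigenvector (R : rcfType) (N d : nat)
    (P : 'M[R]_N) (K : 'M[R]_(d, N)) :
    P^T = P -> row_free K -> (0 < d)%N ->
  exists (mu : R) (z : 'rV[R]_d), z != 0 /\ z *m K *m (P - mu%:M) *m K^T = 0.
Proof.
move=> symP freeK d_gt0.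
have freefK : row_free (map_mx (real_complex R) K) by rewrite row_free_map.
have dot_gt0 (z : 'rV[R[i]]_d) : z != 0 ->
    0 < ((z *m map_mx (real_complex R) K)
         *m (z *m map_mx (real_complex R) K)^t*) 0 0.
  move=> z0; rewrite -dotmxE; apply: dotmx_is_dotmx.
  by rewrite mulmx_free_eq0.
have conjfK : (map_mx (real_complex R) K)^t* = map_mx (real_complex R) K^T.
  by rewrite map_trmx conj_map_real_complex.
(* If [z G = 0], then [z K] has norm zero; the positivity is borrowed from the Hermitian product
   after embedding into the complex numbers. *)
have unitG : K *m K^T \in unitmx.
  rewrite -row_free_unit -kermx_eq0.
  apply/rowV0P => z /sub_kermxP zG0; apply/eqP.
  rewrite -(map_mx_eq0 (real_complex R)).
  apply/negPn/negP => /dot_gt0.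
  rewrite trmxC_mul conjfK mulmxA -[_ *m map_mx _ K^T]mulmxA.
  rewrite -!(map_mxM (real_complex R)).
  by rewrite zG0 map_mx0 mul0mx mxE ltxx.
pose E := K *m P *m K^T *m invmx (K *m K^T).
have [a] := @eigenvalue_closed _ _ (map_mx (real_complex R) E) d_gt0.
move=> eig_a; have [z zE z0] := eigenvalueP eig_a.
set w := z *m map_mx (real_complex R) K.
have wP : w *m map_mx (real_complex R) P *m (map_mx (real_complex R) K)^t*
          = a *: (w *m (map_mx (real_complex R) K)^t*).
  have /= := congr1 (mulmxr (map_mx (real_complex R) (K *m K^T))) zE.
  rewrite -[z *m _ *m _]mulmxA -(map_mxM (real_complex R)) mulmxKV //.
  rewrite !map_mxM !mulmxA conjfK => ->.
  by rewrite -!scalemxAl.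
have conjfP : (map_mx (real_complex R) P)^t* = map_mx (real_complex R) P.
  by rewrite map_trmx conj_map_real_complex symP.
have wPw : w *m map_mx (real_complex R) P *m w^t* = a *: (w *m w^t*).
  by rewrite {2 4}/w trmxC_mul !mulmxA wP -!scalemxAl.
have ww_gt0 : 0 < (w *m w^t*) 0 0 by apply: dot_gt0.
(* [w P w^*] is its own conjugate transpose and equals [a w w^*] with [w w^*] positive. *)
have real_a : a^* = a.
  clearbody w; have /(congr1 (fun M => (M^t*) 0 0)) := wPw.
  rewrite linearZ /= map_mxZ !trmxC_mul trmxCK conjfP mulmxA wPw.
  rewrite [LHS]mxE [RHS]mxE => /esym.
  by apply: mulIf; rewrite gt_eqF.
have /complex_realP [mu def_a]: a \is Num.real by apply/CrealP.
(* A real eigenvalue of the complexified matrix is already an eigenvalue over [R], which gives a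
   real eigenvector. *)
move: eig_a; rewrite def_a eigenvalue_map => /eigenvalueP [x xE x0].
exists mu, x; split=> //.
have := congr1 (mulmxr (K *m K^T)) xE.
rewrite /= -[x *m _ *m _]mulmxA mulmxKV // mulmxBr mulmxBl mul_mx_scalar -!scalemxAl.
by rewrite !mulmxA => ->; rewrite subrr.
Qed.

(* First-order perturbation theory: [x] is an eigenvector of the compression of
   [P] to [ker (M - sigma)], so [x (P - mu)] lies in the orthogonal of that
   kernel, which is the range of [M - sigma]. *)
Lemma dual_symmetric_eigenvector (R : rcfType) (N : nat) (M P : 'M[R]_N) :
    M^T = M -> P^T = P -> (0 < N)%N ->
  exists (sigma mu : R) (x y : 'rV[R]_N),
    [/\ x != 0, x *m M = sigma *: x
      & y *m M + x *m P = sigma *: y + mu *: x].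
Proof.
move=> symM symP N_gt0.
(* Compression to the whole space ([K = 1]) gives an ordinary eigenvalue; its eigenvector [z] serves
   only to show that the kernel of [D] is nonzero. *)
have [||sigma [z [z0 zM]]] := @symmetric_compression_eigenvector R N N M 1%:M symM.
- by rewrite -row_leq_rank mxrank1.
- by [].
move: zM; rewrite trmx1 !mulmx1; set D := M - _ => zD.
have symD : D^T = D by rewrite linearB /= symM tr_scalar_mx.
pose K := row_base (kermx D).
have [||mu [x [x0 xP]]] := @symmetric_compression_eigenvector R N _ P K symP.
- exact: row_base_free.
- rewrite lt0n mxrank_eq0; apply: contraNN z0 => /eqP kerD0.
  by rewrite -submx0 -kerD0; apply/sub_kermxP.
set u := x *m K in xP.
have uD : u *m D = 0.
  by apply/sub_kermxP; rewrite mulmx_sub // eq_row_base.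
have /submxP [y yD] : (u *m (P - mu%:M) <= D)%MS.
  rewrite submxE; have /submxP [C defC] : ((cokermx D)^T <= K)%MS.
    rewrite eq_row_base; apply/sub_kermxP.
    by rewrite -{2}symD -trmx_mul mulmx_coker trmx0.
  by rewrite -[cokermx D]trmxK defC trmx_mul mulmxA xP mul0mx.
exists sigma, mu, u, (- y); split.
- by rewrite mulmx_free_eq0 // row_base_free.
- by apply/eqP; rewrite -subr_eq0 -mul_mx_scalar -mulmxBr uD.
move: yD; rewrite !mulmxBr !mul_mx_scalar mulNmx scalerN => yD.
apply/eqP; rewrite -subr_eq0 opprD opprK addrACA [- _ + _]addrC.
by rewrite -[X in X + _]opprB -yD addNr.
Qed.

(** * From the antilinear map to a real symmetric matrix *)

Definition complexify {R : rcfType} {n : nat} (r : 'rV[R]_(n + n)) :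
    'rV[R[i]]_n :=
  map_mx (real_complex R) (lsubmx r) + 'i *: map_mx (real_complex R) (rsubmx r).

(* The matrix, on real and imaginary parts, of the antilinear map sending a row
   [x] to [conj x A]; unlike that of [x |-> x A], it is symmetric when [A] is. *)
Definition antilinear_realmx {R : rcfType} {n : nat} (A : 'M[R[i]]_n) :
    'M[R]_(n + n) :=
  block_mx (map_mx (@complex.Re R) A) (map_mx (@complex.Im R) A)
           (map_mx (@complex.Im R) A) (- map_mx (@complex.Re R) A).

Section Complexify.

Variables (R : rcfType) (n : nat).

Lemma complexifyD (r s : 'rV[R]_(n + n)) :
  complexify (r + s) = complexify r + complexify s.
Proof. by rewrite /complexify !linearD /= !map_mxD scalerDr addrACA. Qed.

Lemma complexifyZ (a : R) (r : 'rV[R]_(n + n)) :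
  complexify (a *: r) = a%:C *: complexify r.
Proof.
by rewrite /complexify !linearZ /= !map_mxZ scalerDr !scalerA [_ * 'i]mulrC.
Qed.

Lemma complexify_eq0 (r : 'rV[R]_(n + n)) : complexify r = 0 -> r = 0.
Proof.
move=> r0; rewrite -[r]hsubmxK; suff [-> ->] : lsubmx r = 0 /\ rsubmx r = 0.
  exact: row_mx0.
by split; apply/rowP => j; have /rowP/(_ j) := r0; rewrite !mxE => /eqP;
  rewrite eq_complex /= !(mul0r, mul1r, subr0, add0r, addr0) => /andP[/eqP e1 /eqP e2].
Qed.

(** With [x = a + i b] and [A = P + i Q], this is the expansion of [conj x A] as
    [(a P + b Q) + i (a Q - b P)]. *)
Lemma complexify_antilinear (A : 'M[R[i]]_n) (r : 'rV[R]_(n + n)) :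
  complexify (r *m antilinear_realmx A) = map_mx conjC (complexify r) *m A.
Proof.
set a := lsubmx r; set b := rsubmx r.
have defA : A = map_mx (real_complex R) (map_mx (@complex.Re R) A)
                + 'i *: map_mx (real_complex R) (map_mx (@complex.Im R) A).
  by apply/matrixP => i j; rewrite !mxE -complexE.
rewrite /antilinear_realmx; move: (map_mx _ A) (map_mx _ A) defA => Q P defA.
rewrite /complexify -{1 2}[r]hsubmxK mul_row_block row_mxKl row_mxKr -/a -/b.
have -> : map_mx conjC (map_mx (real_complex R) a + 'i *: map_mx (real_complex R) b)
    = map_mx (real_complex R) a - 'i *: map_mx (real_complex R) b.
  rewrite (map_mxD conjC) (map_mxZ conjC) !conj_map_real_complex.
  by rewrite -scaleNr; congr (_ + _ *: _); exact: conjCi.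
rewrite {A}defA mulmxDl mulNmx !mulmxDr mulmxN !map_mxD map_mxN !map_mxM.
rewrite -!scalemxAl -!scalemxAr scalerA -expr2 sqr_i scaleN1r.
rewrite scalerBr opprD opprK -!addrA; congr (_ + _).
by rewrite [RHS]addrA [RHS]addrC.
Qed.

End Complexify.

Lemma antilinear_realmx_sym (R : rcfType) (n : nat) (A : 'M[R[i]]_n) :
  A^T = A -> (antilinear_realmx A)^T = antilinear_realmx A.
Proof.
by move=> symA; rewrite /antilinear_realmx tr_block_mx linearN /= !map_trmx symA.
Qed.

Lemma dual_antilinear_eigenvector (R : rcfType) (n : nat) (As Ai : 'M[R[i]]_n) :
    As^T = As -> Ai^T = Ai -> (0 < n)%N ->
  exists (sigma mu : R) (x y : 'rV[R[i]]_n),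
    [/\ x != 0, map_mx conjC x *m As = sigma%:C *: x
      & map_mx conjC y *m As + map_mx conjC x *m Ai = sigma%:C *: y + mu%:C *: x].
Proof.
move=> symAs symAi n_gt0.
have [sigma [mu [x [y [x0 xE yE]]]]] := dual_symmetric_eigenvector _ _ _ _
  (antilinear_realmx_sym _ _ _ symAs) (antilinear_realmx_sym _ _ _ symAi)
  (ltn_addl n n_gt0).
exists sigma, mu, (complexify x), (complexify y).
rewrite -!complexify_antilinear -!complexifyZ -!complexifyD xE yE; split=> //.
by apply: contraNN x0 => /eqP/complexify_eq0->.
Qed.

(** An antilinear map commutes only with real scalars. Both corrections comply: division by the norm
    of [x], and subtraction from [y] of a real multiple of [x]. *)
Lemma dual_unit_antilinear_eigenvector (R : rcfType) (n : nat) (As Ai : 'M[R[i]]_n) :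
    As^T = As -> Ai^T = Ai -> (0 < n)%N ->
  exists (sigma mu : R) (x y : 'rV[R[i]]_n),
    [/\ x *m x^t* = 1%:M, x *m y^t* + y *m x^t* = 0,
        map_mx conjC x *m As = sigma%:C *: x
      & map_mx conjC y *m As + map_mx conjC x *m Ai = sigma%:C *: y + mu%:C *: x].
Proof.
move=> symAs symAi n_gt0.
have [sigma [mu [x [y [x0 xE yE]]]]] :=
  dual_antilinear_eigenvector _ _ _ _ symAs symAi n_gt0.
have {x0} /dotmx_is_dotmx := x0; rewrite dotmxE; set d := _ 0 0 => d_gt0.
pose c := (sqrtC d)^-1.
have c_gt0 : 0 < c by rewrite invr_gt0 sqrtC_gt0.
have conj_c : conjC c = c by apply: conj_Creal; exact: gtr0_real.
have conjcZ m p (B : 'M[R[i]]_(m, p)) : map_mx conjC (c *: B) = c *: map_mx conjC B.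
  by rewrite map_mxZ; congr (_ *: _).
have xxE : (c *: x) *m (c *: x)^t* = 1%:M.
  rewrite linearZ /= conjcZ -scalemxAl -scalemxAr scalerA [LHS]mx11_scalar.
  by congr _%:M; rewrite mxE -/d -invfM -expr2 sqrtCK mulVf // gt_eqF.
have {}xE : map_mx conjC (c *: x) *m As = sigma%:C *: (c *: x).
  by rewrite conjcZ -scalemxAl xE !scalerA mulrC.
have {}yE : map_mx conjC (c *: y) *m As + map_mx conjC (c *: x) *m Ai
          = sigma%:C *: (c *: y) + mu%:C *: (c *: x).
  rewrite !conjcZ -!scalemxAl -scalerDr yE scalerDr !scalerA.
  by rewrite ![c * _]mulrC.
move: (c *: x) (c *: y) xxE xE yE
  => {d d_gt0 c c_gt0 conj_c conjcZ} {}x {}y xxE xE yE.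
pose h : R[i] := (x *m y^t*) 0 0.
have hE : x *m y^t* = h%:M by rewrite -mx11_scalar.
have hcE : y *m x^t* = (conjC h)%:M.
  rewrite -[y](@trmxCK R[i]) -trmxC_mul hE tr_scalar_mx map_scalar_mx //.
(* [t] is the real part of [x y^*], so that [x y^* + y x^* = 2 t]; replacing [y] by [y - t x]
   cancels this, since [x x^* = 1]. *)
pose t := (h + conjC h) / 2.
have conj_t : conjC t = t.
  by rewrite /t rmorphM rmorphD /= conjCK fmorphV /= conjC_nat addrC.
have conjtZ m p (B : 'M[R[i]]_(m, p)) : map_mx conjC (t *: B) = t *: map_mx conjC B.
  by rewrite map_mxZ; congr (_ *: _).
exists sigma, mu, x, (y - t *: x); split=> //.
  rewrite linearB /= linearZ /= (map_mxB conjC) conjtZ.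
  rewrite mulmxBr mulmxBl -scalemxAr -scalemxAl hE hcE xxE.
  rewrite addrACA -opprD -scalerDl /t -splitr.
  by rewrite scalemx1 -raddfD subrr.
rewrite (map_mxB conjC) conjtZ mulmxBl -scalemxAl xE addrAC yE.
by rewrite scalerBr !scalerA mulrC addrAC.
Qed.

(** * Completing a dual unit row to a dual unitary matrix *)

(** Gram-Schmidt returns a unitary matrix even when the input, here [x] above zero rows, is rank
    deficient. Its first row [u] satisfies [x = c u], and it remains to see that [c = 1]. *)
Lemma unit_row_unitary_completion (C : numClosedFieldType) (n : nat)
    (x : 'rV[C]_(1 + n)) :
  x *m x^t* = 1%:M -> exists2 Q : 'M[C]_(1 + n), Q *m Q^t* = 1%:M & usubmx Q = x.
Proof.
move=> xx; pose A : 'M[C]_(1 + n) := col_mx x 0.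
have unitS : schmidt A \is unitarymx by exact: schmidt_unitarymx.
exists (schmidt A); first exact/unitarymxP.
set i0 : 'I_(1 + n) := lshift n 0.
have defx : row i0 A = x by rewrite rowKu; apply/rowP => j; rewrite mxE.
have -> : usubmx (schmidt A) = row i0 (schmidt A).
  by apply/matrixP => i j; rewrite !ord1 !mxE.
set u := row i0 _.
have uu : u *m u^t* = 1%:M.
  have /row_unitarymxP/(_ i0 i0) := unitS.
  by rewrite dotmxE eqxx => uu; rewrite [LHS]mx11_scalar uu.
have /submxP [c defxu] : (x <= u)%MS.
  rewrite -defx (submx_trans (row_schmidt_sub _ _)) //.
  apply/sumsmx_subP => k; rewrite leqn0 => /eqP k0.
  by rewrite genmxE (_ : k = i0) //; apply: val_inj.
(* Gram-Schmidt makes [x u^* = c] nonnegative, while both rows having norm one gives [c] modulus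
   one. *)
have := form1_row_schmidt A i0; rewrite defx -/u dotmxE defxu -mulmxA uu mulmx1.
move: xx; rewrite defxu trmxC_mul mulmxA -[c *m u *m _]mulmxA uu mulmx1.
rewrite [c]mx11_scalar tr_scalar_mx map_scalar_mx -scalar_mxM.
rewrite mul_scalar_mx mxE eqxx mulr1n /=.
move=> /matrixP/(_ 0 0); rewrite !mxE eqxx !mulr1n => cc c_ge0.
have /eqP: (c 0 0) ^+ 2 = 1.
  by rewrite expr2 -{2}(conj_Creal (ger0_real c_ge0)).
by rewrite sqrp_eq1 // => /eqP->; rewrite scale1r.
Qed.

(** The infinitesimal parts compatible with a unitary [Q] are the [K Q] with [K] skew-Hermitian. The
    first row of [K] must be [y Q^*]; its corner [y x^*] is skew by hypothesis, the first column
    follows, and the remaining block can be zero. *)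
Lemma dual_unitary_completion (C : numClosedFieldType) (n : nat)
    (x y : 'rV[C]_(1 + n)) :
    x *m x^t* = 1%:M -> x *m y^t* + y *m x^t* = 0 ->
  exists Q : dualmx C (1 + n) (1 + n),
    [/\ dual_unitary Q, usubmx (dual_std Q) = x & usubmx (dual_inf Q) = y].
Proof.
move=> xx xy; have [Q QQ defx] := unit_row_unitary_completion _ _ _ xx.
pose k := y *m Q^t*; pose k1 := lsubmx k; pose k2 := rsubmx k.
pose K : 'M[C]_(1 + n) := block_mx k1 k2 (- k2^t*) 0.
have k1E : k1 = y *m x^t*.
  by rewrite /k1 /k -mulmx_lsub -map_lsubmx -trmx_usub defx.
have skewK : K^t* + K = 0.
  rewrite /K tr_block_mx map_block_mx add_block_mx.
  rewrite !k1E trmxC_mul trmxCK xy linearN /= map_mxN trmxCK addNr subrr.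
  by rewrite trmx0 map_mx0 addr0 block_mx0.
exists (DualMx Q (K *m Q)); split=> //.
  apply/dual_unitaryP; split=> //=.
  by rewrite trmxC_mul mulmxA QQ mul1mx -mulmxA QQ mulmx1.
rewrite /= -mul_usub_mx /K block_mxEv col_mxKu hsubmxK.
by rewrite -mulmxA (mulmx1C QQ) mulmx1.
Qed.

(** * Algebra of dual matrices and of their diagonal blocks *)

Lemma dual_mulmxA (F : pzRingType) (m n p q : nat)
    (A : dualmx F m n) (B : dualmx F n p) (D : dualmx F p q) :
  dual_mulmx A (dual_mulmx B D) = dual_mulmx (dual_mulmx A B) D.
Proof.
by rewrite /dual_mulmx /= mulmxDr mulmxDl !mulmxA addrA.
Qed.

Lemma dual_mul1mx (F : pzRingType) (m n : nat) (A : dualmx F m n) :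
  dual_mulmx (dual_1mx F m) A = A.
Proof. by case: A => As Ai; rewrite /dual_mulmx /= !mul1mx mul0mx addr0. Qed.

Lemma dual_mulmx1 (F : pzRingType) (m n : nat) (A : dualmx F m n) :
  dual_mulmx A (dual_1mx F n) = A.
Proof. by case: A => As Ai; rewrite /dual_mulmx /= !mulmx1 mulmx0 add0r. Qed.

Lemma dual_trmxK (F : Type) (m n : nat) (A : dualmx F m n) :
  dual_trmx (dual_trmx A) = A.
Proof. by case: A => As Ai; rewrite /dual_trmx /= !trmxK. Qed.

Lemma dual_trmx_mul (F : comPzRingType) (m n p : nat)
    (A : dualmx F m n) (B : dualmx F n p) :
  dual_trmx (dual_mulmx A B) = dual_mulmx (dual_trmx B) (dual_trmx A).
Proof. by rewrite /dual_trmx /dual_mulmx /= linearD /= !trmx_mul addrC. Qed.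

Lemma dual_ctrmx_mul (C : numClosedFieldType) (m n p : nat)
    (A : dualmx C m n) (B : dualmx C n p) :
  dual_ctrmx (dual_mulmx A B) = dual_mulmx (dual_ctrmx B) (dual_ctrmx A).
Proof.
by rewrite /dual_ctrmx /dual_mulmx /= linearD map_mxD !trmxC_mul addrC.
Qed.

Lemma dual_trmx1 (F : pzRingType) (n : nat) :
  dual_trmx (dual_1mx F n) = dual_1mx F n.
Proof. by rewrite /dual_trmx /= trmx1 trmx0. Qed.

Lemma dual_trmx_ctrmx (C : numClosedFieldType) (m n : nat) (A : dualmx C m n) :
  dual_trmx (dual_ctrmx A) = dual_ctrmx (dual_trmx A).
Proof. by rewrite /dual_trmx /dual_ctrmx /= !map_trmx. Qed.

Lemma dual_unitaryC (C : numClosedFieldType) (n : nat) (Q : dualmx C n n) :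
  dual_unitary Q -> dual_mulmx (dual_ctrmx Q) Q = dual_1mx C n.
Proof.
move=> /dual_unitaryP [QQs QQi]; congr DualMx => /=; first exact: mulmx1C.
(* Conjugating by the standard part turns the infinitesimal equation of [Q Q^* = 1] into that of
   [Q^* Q = 1]. *)
have := congr1 (fun M => (dual_std Q)^t* *m M *m dual_std Q) QQi.
rewrite mulmxDr mulmxDl !mulmxA (mulmx1C QQs) mul1mx.
by rewrite -!mulmxA (mulmx1C QQs) mulmx1 mul0mx mulmx0 addrC.
Qed.

Lemma dual_unitary_mul (C : numClosedFieldType) (n : nat) (Q V : dualmx C n n) :
  dual_unitary Q -> dual_unitary V -> dual_unitary (dual_mulmx Q V).
Proof.
rewrite /dual_unitary => QQ VV; rewrite dual_ctrmx_mul dual_mulmxA.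
by rewrite -[dual_mulmx (dual_mulmx Q V) _]dual_mulmxA VV dual_mulmx1.
Qed.

Lemma dual_unitary_trmx (C : numClosedFieldType) (n : nat) (Q : dualmx C n n) :
  dual_unitary Q -> dual_unitary (dual_trmx Q).
Proof.
move=> /dual_unitaryC/(congr1 (@dual_trmx _ _ _)).
by rewrite dual_trmx_mul dual_trmx1 dual_trmx_ctrmx.
Qed.

Definition dual_block_diag {F : pzRingType} {m n : nat}
    (A : dualmx F m m) (B : dualmx F n n) : dualmx F (m + n) (m + n) :=
  DualMx (block_mx (dual_std A) 0 0 (dual_std B))
         (block_mx (dual_inf A) 0 0 (dual_inf B)).

Lemma dual_block_diag_mul (F : pzRingType) (m n : nat)
    (A A' : dualmx F m m) (B B' : dualmx F n n) :
  dual_mulmx (dual_block_diag A B) (dual_block_diag A' B')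
  = dual_block_diag (dual_mulmx A A') (dual_mulmx B B').
Proof.
rewrite /dual_mulmx /dual_block_diag /= !mulmx_block.
by rewrite !(mulmx0, mul0mx) !(addr0, add0r) add_block_mx !addr0.
Qed.

Lemma dual_block_diag1 (F : pzRingType) (m n : nat) :
  dual_block_diag (dual_1mx F m) (dual_1mx F n) = dual_1mx F (m + n).
Proof. by rewrite /dual_block_diag /= -scalar_mx_block block_mx0. Qed.

Lemma dual_block_diag_trmx (F : pzRingType) (m n : nat)
    (A : dualmx F m m) (B : dualmx F n n) :
  dual_trmx (dual_block_diag A B) = dual_block_diag (dual_trmx A) (dual_trmx B).
Proof. by rewrite /dual_trmx /= !tr_block_mx !trmx0. Qed.

Lemma dual_block_diag_ctrmx (C : numClosedFieldType) (m n : nat)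
    (A : dualmx C m m) (B : dualmx C n n) :
  dual_ctrmx (dual_block_diag A B) = dual_block_diag (dual_ctrmx A) (dual_ctrmx B).
Proof. by rewrite /dual_ctrmx /= !tr_block_mx !map_block_mx !trmx0 !map_mx0. Qed.

Lemma dual_block_diag_map (F G : pzRingType) (f : {rmorphism F -> G}) (m n : nat)
    (A : dualmx F m m) (B : dualmx F n n) :
  dual_map f (dual_block_diag A B) = dual_block_diag (dual_map f A) (dual_map f B).
Proof. by rewrite /dual_map /= !map_block_mx !map_mx0. Qed.

Lemma dual_block_diag_diagonal (F : pzRingType) (m n : nat)
    (A : dualmx F m m) (B : dualmx F n n) :
  dual_diagonal A -> dual_diagonal B -> dual_diagonal (dual_block_diag A B).
Proof.
by move=> [As Ai] [Bs Bi]; split; rewrite is_diag_block_mx //; apply/and4P.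
Qed.

Lemma dual_unitary1 (C : numClosedFieldType) (n : nat) : dual_unitary (dual_1mx C n).
Proof.
rewrite /dual_unitary dual_mul1mx /dual_ctrmx /= trmx1 map_mx1 trmx0.
by rewrite (map_mx0 conjC).
Qed.

Lemma dual_block_diag_unitary (C : numClosedFieldType) (m n : nat)
    (A : dualmx C m m) (B : dualmx C n n) :
  dual_unitary A -> dual_unitary B -> dual_unitary (dual_block_diag A B).
Proof.
rewrite /dual_unitary dual_block_diag_ctrmx dual_block_diag_mul => -> ->.
exact: dual_block_diag1.
Qed.

Lemma dual_flatmx0 (F : pzRingType) (n : nat) (A B : dualmx F 0 n) : A = B.
Proof.
by case: A B => As Ai [Bs Bi]; congr DualMx; rewrite [LHS]flatmx0 [RHS]flatmx0.
Qed.

(** * Deflation and induction on the size *)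

(** [dual_ctrmx (dual_trmx Q)] is the entrywise conjugate of [Q]. Its first row times [A] is
    [lambda] times the first row of [Q], which [Q^*] sends to the first basis row; symmetry then
    clears the first column. *)
Lemma dual_takagi_deflation (R : rcfType) (n : nat)
    (A : dualmx R[i] (1 + n) (1 + n)) :
    dual_symmetric A ->
  exists (Q : dualmx R[i] (1 + n) (1 + n)) (lambda : dualmx R 1 1)
    (B : dualmx R[i] n n),
    [/\ dual_unitary Q, dual_symmetric B &
      dual_mulmx (dual_mulmx (dual_ctrmx (dual_trmx Q)) A) (dual_ctrmx Q)
        = dual_block_diag (dual_map (real_complex R) lambda) B].
Proof.
move=> symA; have /dual_symmetricP [symAs symAi] := symA.
have [sigma [mu [x [y [xx xy xE yE]]]]] :=
  dual_unit_antilinear_eigenvector _ _ _ _ symAs symAi (ltn0Sn n : 0 < 1 + n)%N.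
have [Q [unitQ defx defy]] := dual_unitary_completion _ _ _ _ xx xy.
pose M := dual_mulmx (dual_mulmx (dual_ctrmx (dual_trmx Q)) A) (dual_ctrmx Q).
have symM : dual_symmetric M.
  rewrite /dual_symmetric /M !dual_trmx_mul symA dual_mulmxA.
  by rewrite !dual_trmx_ctrmx dual_trmxK.
have /dual_symmetricP [symMs symMi] := symM.
have block_symmetric (N : 'M[R[i]]_(1 + n)) (a : R) : N^T = N ->
    usubmx N = a%:C *: row_mx 1%:M 0 ->
    N = block_mx (a%:C)%:M 0 0 (drsubmx N) /\ (drsubmx N)^T = drsubmx N.
  move=> symN uN; split; last by rewrite trmx_drsub symN.
  rewrite -[N in LHS]submxK; congr block_mx.
  - by rewrite /ulsubmx uN linearZ /= row_mxKl scalemx1.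
  - by rewrite /ursubmx uN linearZ /= row_mxKr scaler0.
  by rewrite -symN -trmx_ursub /ursubmx uN linearZ /= row_mxKr scaler0 trmx0.
have /dual_unitaryP [QQs QQi] := unitQ.
have [|Ms symBs] := block_symmetric (dual_std M) sigma symMs.
  rewrite /= trmxK -!mul_usub_mx -map_usubmx defx xE -scalemxAl -defx.
  rewrite mul_usub_mx QQs.
  by rewrite scalar_mx_block block_mxEv col_mxKu.
have [|Mi symBi] := block_symmetric (dual_inf M) mu symMi.
  rewrite /= !trmxK.
  rewrite linearD /= -!mul_usub_mx linearD /= -!mul_usub_mx -!map_usubmx defx defy.
  rewrite [_ *m dual_inf A + _]addrC yE xE mulmxDl -!scalemxAl addrA -scalerDr.
  rewrite -{1 2}defx -defy !mul_usub_mx -linearD /= QQi linear0 scaler0 add0r.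
  by rewrite QQs scalar_mx_block block_mxEv col_mxKu.
exists Q, (DualMx sigma%:M mu%:M),
  (DualMx (drsubmx (dual_std M)) (drsubmx (dual_inf M))).
split=> //; first by apply/dual_symmetricP.
by rewrite /dual_block_diag /dual_map /= !map_scalar_mx -Ms -Mi.
Qed.

Lemma dual_takagi (R : rcfType) (n : nat) (A : dualmx R[i] n n) :
    dual_symmetric A ->
  exists (V : dualmx R[i] n n) (Sigma : dualmx R n n),
    [/\ dual_unitary V,
        dual_diagonal Sigma &
        A = dual_mulmx (dual_mulmx V (dual_map (real_complex R) Sigma))
                       (dual_trmx V)].
Proof.
elim: n => [|n IHn] in A *.
  exists (dual_1mx _ 0), (dual_1mx _ 0); split.
  - exact: dual_flatmx0.
  - by split; apply/is_diag_mxP => -[].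
  - exact: dual_flatmx0.
rewrite -[n.+1]/(1 + n)%N in A * => symA.
have [Q [lambda [B [unitQ symB QA]]]] := dual_takagi_deflation _ n A symA.
have [V [Sigma [unitV diagSigma defB]]] := IHn B symB.
(* Since [Q^T] inverts the conjugate of [Q], and [Q] inverts [Q^*], deflation reads
   [A = Q^T diag(lambda, B) Q]; then [B = V Sigma V^T] is substituted. *)
exists (dual_mulmx (dual_trmx Q) (dual_block_diag (dual_1mx _ 1) V)).
exists (dual_block_diag lambda Sigma); split.
- apply: dual_unitary_mul; first exact: dual_unitary_trmx.
  by apply: dual_block_diag_unitary unitV; apply: dual_unitary1.
- apply: dual_block_diag_diagonal => //.
  by split; apply/is_diag_mxP => i j; rewrite !ord1.
have midE : dual_mulmx (dual_mulmx (dual_block_diag (dual_1mx _ 1) V)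
      (dual_map (real_complex R) (dual_block_diag lambda Sigma)))
    (dual_trmx (dual_block_diag (dual_1mx _ 1) V))
    = dual_block_diag (dual_map (real_complex R) lambda) B.
  rewrite dual_block_diag_map dual_block_diag_trmx !dual_block_diag_mul.
  by rewrite dual_trmx1 dual_mul1mx dual_mulmx1 defB.
rewrite dual_trmx_mul dual_trmxK dual_mulmxA.
rewrite -[dual_mulmx (dual_mulmx (dual_trmx Q) _) _]dual_mulmxA.
rewrite -[dual_mulmx (dual_mulmx (dual_trmx Q) _) (dual_trmx _)]dual_mulmxA.
rewrite midE -QA !dual_mulmxA (dual_unitary_trmx _ _ _ unitQ) dual_mul1mx.
by rewrite -dual_mulmxA dual_unitaryC // dual_mulmx1.
Qed.

Theorem theorem3p1 (R : realType) (n : nat) (A : dualmx R[i] n n)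
    (symA : dual_symmetric A) :
  exists (V : dualmx R[i] n n) (Sigma : dualmx R n n),
    [/\ dual_unitary V,
        dual_diagonal Sigma &
        A = dual_mulmx (dual_mulmx V (dual_map (real_complex R) Sigma))
                       (dual_trmx V)].
Proof. exact: dual_takagi. Qed.
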